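(* Let $n\ge 1$, fix an ordering $\mathcal{A}_1,\mathcal{A}_2,\ldots,\mathcal{A}_N$ of the set $Part_n$ of all partitions of $\{1,2,\ldots,n\}$, and let $A=(a_{ij})_{1\le i,j\le N}$ be the connectivity matrix, i.e. $a_{ij}=1$ if $\mathcal{A}_i\cdot\mathcal{A}_j$ is the trivial partition $\{\{1,2,\ldots,n\}\}$ and $a_{ij}=0$ otherwise. Then $$\det(A)=\pm\prod_{\mathcal{A}\in Part_n}(m_{\mathcal{A}}-1)!,$$ where $m_{\mathcal{A}}$ is the number of classes (blocks) of the partition $\mathcal{A}$. In particular, $A$ is invertible (over $\mathbb{Q}$).
   Context: $Part_n$ denotes the set of all set partitions of $\{1,2,\ldots,n\}$. For partitions $\mathcal{A},\mathcal{B}\in Part_n$, the product $\mathcal{A}\cdot\mathcal{B}$ is the finest partition that is coarser than (or equal to) both $\mathcal{A}$ and $\mathcal{B}$. The trivial partition is the one-block partition $\{\{1,2,\ldots,n\}\}$. The symbol $\pm$ means that the equality holds for one choice of sign (which may depend on $n$). *)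

(* Defs.v *)
From mathcomp Require Import all_boot all_order all_algebra.

Set Implicit Arguments.
Unset Strict Implicit.
Unset Printing Implicit Defensive.

Import GRing.Theory.

Definition Part (n : nat) : finType :=
  {P : {set {set 'I_n}} | partition P [set: 'I_n]}.

Definition nblocks n (P : Part n) : nat := #|val P|.

Definition refines n (P Q : Part n) : bool :=
  [forall X in val P, [exists Y in val Q, X \subset Y]].

Definition is_product n (P Q C : Part n) : bool :=
  [&& refines P C, refines Q C &
      [forall D : Part n, refines P D && refines Q D ==> refines C D]].

Lemma refinesP n (P Q : Part n) :
  reflect (forall x y, pblock (val P) x = pblock (val P) y ->
                       pblock (val Q) x = pblock (val Q) y)
          (refines P Q).
Proof.
case: P Q => [P partP] [Q partQ]; rewrite /refines /=.
have [/eqP covP trP P0] := and3P partP.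
have [/eqP covQ trQ Q0] := and3P partQ.
have inP x : x \in cover P by rewrite covP inE.
have inQ x : x \in cover Q by rewrite covQ inE.
apply: (iffP forall_inP) => [PQ x y eqP | PQ X XP].
  have /exists_inP[Y YQ /subsetP sXY] := PQ _ (pblock_mem (inP x)).
  have xY : x \in Y by apply: sXY; rewrite mem_pblock.
  have yY : y \in Y by apply: sXY; rewrite eqP mem_pblock.
  by rewrite (def_pblock trQ YQ xY) (def_pblock trQ YQ yY).
have /set0Pn[x xX] : X != set0 by apply: contraNneq P0 => <-.
apply/exists_inP; exists (pblock Q x); first exact: pblock_mem.
apply/subsetP => y yX; rewrite (PQ x y) ?mem_pblock //.
by rewrite (def_pblock trP XP xX) (def_pblock trP XP yX).
Qed.

Lemma product_exists n (P Q : Part n) : exists C, is_product P Q C.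
Proof.
pose R (x y : 'I_n) := [forall D : Part n, refines P D && refines Q D ==>
                          (pblock (val D) x == pblock (val D) y)].
have RP x y : reflect (forall D : Part n, refines P D -> refines Q D ->
    pblock (val D) x = pblock (val D) y) (R x y).
  apply: (iffP forallP) => [h D PD QD | h D].
    by have := h D; rewrite PD QD => /eqP.
  by apply/implyP => /andP[PD QD]; apply/eqP/h.
have eqR : {in [set: 'I_n] & &, equivalence_rel R}.
  move=> x y z _ _ _; split; first by apply/RP.
  move=> /RP xy; apply/RP/RP => h D PD QD; first by rewrite -xy // h.
  by rewrite xy // h.
have partC := equivalence_partitionP eqR.
pose C : Part n :=
  exist (fun S : {set {set 'I_n}} => partition S [set: 'I_n]) _ partC.
have CE x y : (pblock (val C) x = pblock (val C) y) <-> R x y.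
  have [/eqP covC trC _] := and3P partC.
  rewrite -(pblock_equivalence_partition eqR) ?inE //.
  have xC : x \in cover (val C) by rewrite covC inE.
  have yC : y \in cover (val C) by rewrite covC inE.
  by rewrite -eq_pblock //; split => /eqP.
exists C; apply/and3P; split.
- by apply/refinesP => x y xy; apply/CE/RP => D /refinesP/(_ _ _ xy).
- by apply/refinesP => x y xy; apply/CE/RP => D _ /refinesP/(_ _ _ xy).
apply/forallP => D; apply/implyP => /andP[PD QD].
by apply/refinesP => x y /CE/RP; apply.
Qed.

(* The finest partition coarser than (or equal to) both P and Q. *)
Definition product n (P Q : Part n) : Part n := xchoose (product_exists P Q).

Lemma productP n (P Q : Part n) : is_product P Q (product P Q).
Proof. exact: xchooseP. Qed.

Lemma refines_anti n (P Q : Part n) : refines P Q -> refines Q P -> P = Q.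
Proof.
move=> /refinesP PQ /refinesP QP.
have eqb x y : (y \in pblock (val P) x) = (y \in pblock (val Q) x).
  have [/eqP cP tP _] := and3P (valP P); have [/eqP cQ tQ _] := and3P (valP Q).
  rewrite -!eq_pblock ?cP ?cQ ?inE //.
  by apply/eqP/eqP => [/PQ | /QP].
have sub (U V : Part n) :
    (forall x, pblock (val U) x = pblock (val V) x) -> val U \subset val V.
  move=> UV; have [_ tU U0] := and3P (valP U).
  have [/eqP cV _ _] := and3P (valP V).
  apply/subsetP => X XU.
  have /set0Pn[x xX] : X != set0 by apply: contraNneq U0 => <-.
  by rewrite -(def_pblock tU XU xX) UV pblock_mem // cV inE.
apply/val_inj/eqP; rewrite eqEsubset !sub // => x;
  by apply/setP => y; rewrite eqb.
Qed.

Lemma product_unique n (P Q C : Part n) : is_product P Q C -> C = product P Q.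
Proof.
have /and3P[PX QX /forallP minX] := productP P Q.
move=> /and3P[PC QC /forallP minC]; apply: refines_anti.
  by have := minC (product P Q); rewrite PX QX.
by have := minX C; rewrite PC QC.
Qed.

(* As a raw set of sets: for n = 0 it is not a partition. *)
Definition trivial_partition (n : nat) : {set {set 'I_n}} :=
  [set [set: 'I_n]].

Definition connectivity_matrix n N (P : 'I_N -> Part n) : 'M[rat]_N :=
  (\matrix_(i, j) (val (product (P i) (P j)) == trivial_partition n)%:R)%R.

(* Main.v *)
Require Import Defs.
From mathcomp Require Import all_boot all_order all_algebra.
From mathcomp Require Import fingroup perm.

Set Implicit Arguments.
Unset Strict Implicit.
Unset Printing Implicit Defensive.

Import GRing.Theory.
Local Open Scope ring_scope.

(** The connectivity matrix is a congruence of a diagonal matrix by a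
    unitriangular one. Let Z be the 0-1 matrix of the refinement order on
    partitions, and let weight m = (-1)^(m-1) (m-1)!, which is the Moebius
    function of the partition lattice from a partition with m blocks up to the
    one-block partition. For every partition X, the weights of the partitions
    coarser than X add up to 1 if X has one block and to 0 otherwise
    (sum_coarser). A partition is coarser than the product of P and Q exactly
    when it is coarser than both P and Q, so taking X to be that product gives
    A = Z D Z^T with D the diagonal matrix of the weights (connectivity_sum).
    Since Z is the matrix of an order relation, its determinant is 1
    (det_order), hence det A is the product of the weights.

    The sum of the weights is evaluated by pairing off its terms. Fix a block B
    of X, where X has several blocks, and let Y range over the partitions
    coarser than X. If B is not a block of Y, then the block of Y containing B
    can be cut into B and the rest C; this identifies Y with a pair (Q, C)
    where Q is coarser than X, B is a block of Q, and C is another block of Q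
    (mergeP and split_offP). If Q has k + 1 blocks, then Q and the k partitions
    obtained from it contribute weight (k + 1) + k weight k, which is 0. *)

(** * Merging a block into another one *)

(** The refinement order, on families of subsets of an arbitrary finite type;
    for partitions of an ordinal type it is the relation refines. *)
Definition coarser (T : finType) (X Y : {set {set T}}) : bool :=
  [forall A in X, [exists C in Y, A \subset C]].

Lemma coarserP (T : finType) (X Y : {set {set T}}) :
  reflect (forall A, A \in X -> exists2 C, C \in Y & A \subset C)
          (coarser X Y).
Proof. by apply: (iffP forall_inP) => h A /h/exists_inP. Qed.

Lemma block_full (T : finType) (D : {set T}) (P : {set {set T}}) :
  partition P D -> D \in P -> P = [set D].
Proof.
move=> partP DP; have := partitionD1 partP DP.
rewrite setDv partition_set0 => /eqP PD0.
by rewrite -(setD1K DP) PD0 setU0.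
Qed.

(** A block would be a subset of D, and only the empty set is both a subset of
    D and disjoint from D. *)
Lemma partition_notin (T : finType) (D B : {set T}) (P : {set {set T}}) :
  partition P D -> B != set0 -> [disjoint B & D] -> B \notin P.
Proof.
move=> partP B0 dBD; apply: contraNN B0 => /(partitionS partP)/setIidPl <-.
by rewrite setI_eq0.
Qed.

(** Taking a pair as argument makes this the inverse of split_off as a
    function, which is the form needed to reindex a sum. *)
Definition merge (T : finType) (B : {set T}) (QC : {set {set T}} * {set T}) :=
  (B :|: QC.2) |: (QC.1 :\ B :\ QC.2).

(** The point b stands for the block B that contains it: when Y is coarser than
    a partition with block B, the block of Y at b is the one including B. *)
Definition split_off (T : finType) (B : {set T}) b (Y : {set {set T}}) :=
  let K := pblock Y b in (B |: ((K :\: B) |: (Y :\ K)), K :\: B).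

(** One half of the bijection used to pair off the partitions coarser than X:
    merging leaves a partition in which B is no longer a block, and the pair is
    recovered because C is what remains of the merged block without B. *)
Lemma mergeP (T : finType) (D B : {set T}) b (X Q : {set {set T}}) C :
  b \in B -> partition Q D -> coarser X Q -> B \in Q -> C \in Q :\ B ->
  let Y := merge B (Q, C) in
  [/\ partition Y D, coarser X Y, B \notin Y, split_off B b Y = (Q, C)
    & #|Y| = #|Q :\ B| ].
Proof.
move=> bB pQ /coarserP XQ BQ CQB; have [CB CQ] := setD1P CQB.
have pQB := partitionD1 pQ BQ; have pR := partitionD1 pQB CQB.
rewrite /merge /=; set R := Q :\ B :\ C in pR *; set K := B :|: C.
have dCB : [disjoint C & B] by have /trivIsetP := partition_trivIset pQ; apply.
have C0 := partition_neq0 pQ CQ.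
have KB : K :\: B = C by rewrite setDUl setDv set0U; apply/setDidPl.
have BK : B != K by apply: contraNneq C0 => eBK; rewrite -KB -eBK setDv.
have K0 : K != set0 by apply/set0Pn; exists b; rewrite inE bB.
have sKD : K \subset D by rewrite subUset !(partitionS pQ).
rewrite setDDl -/K in pR.
have dKD : [disjoint K & D :\: K].
  by rewrite -setI_eq0 setIDA (setIidPl sKD) setDv.
have KR := partition_notin pR K0 dKD.
have pY : partition (K |: R) D.
  by rewrite -(setID D K) (setIidPr sKD); apply: partitionU1.
split=> //.
- apply/coarserP => A /XQ[Z ZQ AZ].
  have [ZB | ZB] := eqVneq Z B.
    by exists K; rewrite ?setU11 // (subset_trans AZ) // ZB subsetUl.
  have [ZC | ZC] := eqVneq Z C.
    by exists K; rewrite ?setU11 // (subset_trans AZ) // ZC subsetUr.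
  by exists Z; rewrite // !inE ZB ZC ZQ orbT.
- by rewrite !inE eqxx negb_or BK andbF.
- rewrite /split_off (def_pblock (partition_trivIset pY) (setU11 _ _)) ?inE ?bB //.
  by rewrite setU1K // KB setD1K // setD1K.
- by rewrite cardsU1 KR [in RHS](cardsD1 C) CQB.
Qed.

(** The other half. The rest C of the block K including B is nonempty since B is
    not itself a block; coarseness survives the cut because every block of X
    other than B is disjoint from B, so that if it lies in K it lies in C. *)
Lemma split_offP (T : finType) (D B : {set T}) b (X Y : {set {set T}}) :
  b \in B -> partition X D -> B \in X ->
  partition Y D -> coarser X Y -> B \notin Y ->
  let QC := split_off B b Y in
  [/\ partition QC.1 D, coarser X QC.1, B \in QC.1, QC.2 \in QC.1 :\ B
    & merge B QC = Y].
Proof.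
move=> bB pX BX pY /coarserP XY BY; rewrite /split_off /=.
have [K KY sBK] := XY _ BX.
rewrite (def_pblock (partition_trivIset pY) KY (subsetP sBK _ bB)).
set C := K :\: B; set R := Y :\ K.
have pR : partition R (D :\: K) := partitionD1 pY KY.
have sKD := partitionS pY KY.
have KE : B :|: C = K by rewrite -[in RHS](setID K B) (setIidPr sBK).
have B0 : B != set0 by apply/set0Pn; exists b.
have C0 : C != set0.
  by apply: contraNneq BY => C0; rewrite -[B]setU0 -C0 KE.
have sCK : C \subset K by apply: subsetDl.
have CDB : C :|: (D :\: K) = D :\: B.
  rewrite -[in RHS](setID D K) (setIidPr sKD) setDUl -/C; congr (_ :|: _).
  by rewrite setDDl setUC (setUidPr sBK).
have pCR : partition (C |: R) (D :\: B).
  rewrite -CDB; apply: partitionU1 => //.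
  by rewrite disjoint_sym disjoints_subset setDE subIset // setCS sCK orbT.
have dBD : [disjoint B & D :\: B].
  by rewrite disjoint_sym disjoints_subset setDE subsetIr.
have BCR := partition_notin pCR B0 dBD.
have pQ : partition (B |: (C |: R)) D.
  rewrite -[D](setID D B) (setIidPr (subset_trans sBK sKD)).
  exact: partitionU1.
have CR : C \notin R.
  apply: (partition_notin pR C0).
  by rewrite disjoint_sym disjoints_subset setDE subIset // setCS sCK orbT.
split=> //.
- apply/coarserP => A AX; have [-> | AB] := eqVneq A B.
    by exists B; rewrite ?setU11.
  have [Z ZY AZ] := XY _ AX.
  have [ZK | ZK] := eqVneq Z K; last first.
    by exists Z; rewrite // !inE ZK ZY !orbT.
  exists C; rewrite ?inE ?eqxx ?orbT // subsetD -ZK AZ.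
  by have /trivIsetP := partition_trivIset pX; apply.
- exact: setU11.
- by rewrite setU1K // setU11.
- by rewrite /merge /= setU1K // setU1K // KE setD1K.
Qed.

(** * Summing over the coarsenings of a partition *)

(** For k > 0, the Moebius function of the lattice of partitions of a k-element
    set, from its bottom to its top. *)
Definition weight (k : nat) : rat := (-1) ^+ k.-1 * (k.-1`!)%:R.

(** The cancellation between a partition with k + 1 blocks and the k partitions
    obtained by merging a given block with one of the others. *)
Lemma weight_rec k : (0 < k)%N -> weight k.+1 + weight k *+ k = 0.
Proof.
case: k => // k _; rewrite /weight /= factS natrM exprS mulN1r mulNr.
by rewrite mulr_natl -mulrnAr addNr.
Qed.

(** This is the defining recursion of the Moebius function up to the one-block
    partition. If X has several blocks, then the terms cancel in groups, a
    group consisting of some Q having the fixed block B of X as a block and of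
    all the results of merging B with another block of Q. *)
Lemma sum_coarser (T : finType) (D : {set T}) (X : {set {set T}}) :
  D != set0 -> partition X D ->
  \sum_(Y | partition Y D && coarser X Y) weight #|Y| = (X == [set D])%:R.
Proof.
move=> D0 pX; have [XD | XD] := eqVneq X [set D].
  rewrite (big_pred1 [set D]) ?cards1 ?/weight ?mulr1 // => Y.
  rewrite /= XD in pX *; apply/andP/eqP => [[pY /coarserP] | ->].
    case/(_ D (set11 _)) => C CY DC; apply: block_full => //.
    suff -> : D = C by [].
    by apply/eqP; rewrite eqEsubset DC (partitionS pY).
  by split=> //; apply/coarserP => A; exists A.
have [b bD] := set0Pn _ D0.
rewrite -(cover_partition pX) in bD.
set B := pblock X b; have BX : B \in X := pblock_mem bD.
have bB : b \in B by rewrite mem_pblock.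
(* The Y without block B become pairs (Q, C), summed over C for each Q. *)
rewrite (bigID (fun Y : {set {set T}} => B \in Y)) /=.
rewrite [X in _ + X = _](reindex_onto (merge B) (split_off B b)) /=; last first.
  move=> Y /andP[/andP[pY XY] BY].
  by case: (split_offP bB pX BX pY XY BY).
rewrite (eq_bigl (fun QC : {set {set T}} * {set T} =>
    [&& partition QC.1 D, coarser X QC.1 & B \in QC.1] &&
    (QC.2 \in QC.1 :\ B))); last first.
  move=> [Q C] /=; apply/andP/andP.
    move=> [/andP[/andP[pY XY] BY] /eqP sE].
    by have [] := split_offP bB pX BX pY XY BY; rewrite sE => -> -> -> ->.
  move=> [/and3P[pQ XQ BQ] CQB].
  by have [-> -> -> -> _] := mergeP bB pQ XQ BQ CQB.
rewrite -(pair_big_dep (fun Q => [&& partition Q D, coarser X Q & B \in Q])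
  (fun Q C => C \in Q :\ B) (fun Q C => weight #|merge B (Q, C)|)) /=.
rewrite [X in X + _ = _](eq_bigl (fun Q =>
    [&& partition Q D, coarser X Q & B \in Q])); last first.
  by move=> Q; rewrite andbA.
rewrite -big_split big1 //= => Q /and3P[pQ XQ BQ].
rewrite (eq_bigr (fun=> weight #|Q :\ B|)); last first.
  by move=> C CQB; have [_ _ _ _ ->] := mergeP bB pQ XQ BQ CQB.
(* B is not the only block of Q: otherwise B = D would be a block of X. *)
rewrite sumr_const (cardsD1 B Q) BQ weight_rec // card_gt0.
apply: contraNneq XD => QB0.
have eQB : Q = [set B] by rewrite -(setD1K BQ) QB0 setU0.
have eBD : B = D by rewrite -(cover_partition pQ) eQB /cover big_set1.
by apply/eqP/block_full; rewrite // -eBD.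
Qed.

(** * The determinant of an order relation *)

(** In the Leibniz expansion a permutation s contributes only if x <= s x for
    all x. Following the cycle of x through s x back to x gives s x <= x, so s
    fixes every point. This avoids sorting the indices along a linear
    extension to make the matrix triangular. *)
Lemma det_order (R : comNzRingType) N (e : rel 'I_N) :
  reflexive e -> antisymmetric e -> transitive e ->
  \det (\matrix_(i, j) (e i j)%:R : 'M[R]_N) = 1.
Proof.
move=> refl_e anti_e trans_e; rewrite /determinant (bigD1 1%g) //=.
rewrite odd_perm1 mul1r big1 ?mul1r => [|i _]; last by rewrite mxE perm1 refl_e.
rewrite big1 ?addr0 // => s s1.
have [/forallP es | /forallPn[i nesi]] := boolP [forall i, e i (s i)]; last first.
  by rewrite (bigD1 i) //= mxE (negPf nesi) mul0r mulr0.
case/eqP: s1; apply/permP => i; rewrite perm1; apply: anti_e.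
rewrite es andbT.
have e_iter k x : e x ((s ^+ k)%g x).
  elim: k x => [|k IHk] x; first by rewrite expg0 perm1.
  by rewrite expgSr permM (trans_e _ _ _ (IHk x)).
(* Applying s to s i one time less than its order leads back to i. *)
have := e_iter #[s]%g.-1 (s i).
by rewrite -permM -expgS prednK ?order_gt0 // expg_order perm1.
Qed.

(** * The connectivity matrix *)

Lemma refines_refl n : reflexive (@refines n).
Proof. by move=> P; apply/refinesP. Qed.

Lemma refines_trans n : transitive (@refines n).
Proof.
by move=> Q P S /refinesP PQ /refinesP QS; apply/refinesP => x y /PQ/QS.
Qed.

Lemma refines_product n (P Q Y : Part n) :
  refines (product P Q) Y = refines P Y && refines Q Y.
Proof.
have /and3P[PC QC /forallP minC] := productP P Q.
apply/idP/andP => [CY | [PY QY]]; first by split; apply: refines_trans CY.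
by have := minC Y; rewrite PY QY.
Qed.

(** The entry of the factorization A = Z D Z^T at P and Q. Nonemptiness of the
    ground set matters: the empty set has a single partition, with no blocks. *)
Lemma connectivity_sum n (n_gt0 : (1 <= n)%N) (P Q : Part n) :
  (val (product P Q) == trivial_partition n)%:R =
  \sum_(Y : Part n) (refines P Y)%:R * weight (nblocks Y) * (refines Q Y)%:R.
Proof.
have D0 : [set: 'I_n] != set0 by apply/set0Pn; exists (Ordinal n_gt0).
rewrite /trivial_partition -(sum_coarser D0 (valP (product P Q))).
rewrite (big_sub_cond [pred Y | partition Y [set: 'I_n]]
          (coarser (val (product P Q))) (fun Y => weight #|Y|)) big_mkcond /=.
apply: eq_bigr => Y _; rewrite -[coarser _ _]/(refines (product P Q) Y).
rewrite refines_product.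
by case: (refines P Y); case: (refines Q Y); rewrite ?mulr1 ?mul1r ?mulr0 ?mul0r.
Qed.

Theorem theorem1p1 (n : nat) (n_gt0 : (1 <= n)%N) :
  exists sgn : bool,
    forall (N : nat) (P : 'I_N -> Part n), bijective P ->
      \det (connectivity_matrix P)
        = (-1) ^+ sgn * \prod_(Q : Part n) ((nblocks Q - 1)`!)%:R
      /\ connectivity_matrix P \in unitmx.
Proof.
exists (odd (\sum_(Q : Part n) (nblocks Q).-1)) => N P bijP.
pose Z : 'M[rat]_N := \matrix_(i, j) (refines (P i) (P j))%:R.
have detZ : \det Z = 1.
  apply: (@det_order _ N (fun i j => refines (P i) (P j))).
  - by move=> i; apply: refines_refl.
  - by move=> i j /andP[ij ji]; apply: (bij_inj bijP); apply: refines_anti.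
  - by move=> j i k; apply: refines_trans.
(* Z and the weights are indexed through P, so that the sum over all
   partitions becomes a sum over indices. *)
have factor : connectivity_matrix P
    = Z *m diag_mx (\row_j weight (nblocks (P j))) *m Z^T.
  apply/matrixP => i j; rewrite !mxE (connectivity_sum n_gt0).
  rewrite (reindex P) /=; last exact: onW_bij.
  by apply: eq_bigr => k _; rewrite mul_mx_diag !mxE.
have det_eq : \det (connectivity_matrix P)
    = (-1) ^+ odd (\sum_(Q : Part n) (nblocks Q).-1)
      * \prod_(Q : Part n) ((nblocks Q - 1)`!)%:R.
  rewrite factor !det_mulmx det_tr detZ mul1r mulr1 det_diag signr_odd.
  rewrite expr_sum -big_split [RHS](reindex P) /=; last exact: onW_bij.
  by apply: eq_bigr => j _; rewrite mxE /weight subn1.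
split=> //; rewrite unitmxE unitfE det_eq mulf_neq0 ?signr_eq0 //.
by apply/prodf_neq0 => Q _; rewrite Num.Theory.pnatr_eq0 -lt0n fact_gt0.
Qed.
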